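(* Let $G$ be a unicyclic graph with $n \ge 4$ vertices and maximum degree $\Delta \ge 3$, and let $f : [1,\infty) \to \mathbb{R}$ be a concave function. Then $$ I_f(G) \le f(\Delta) + (n-\Delta+1) f(2) + (\Delta-2) f(1), $$ and the inequality is attained (i.e., equality holds) if and only if $G \in \mathcal{H}_n^\Delta$.
   Context: All graphs are finite, connected, simple (no loops, no multiple edges) and have at least one edge. A unicyclic graph is a graph containing exactly one cycle. For a vertex $u$ of $G$, $d_u$ denotes its degree. For a function $f:[1,\infty)\to\mathbb{R}$, $I_f(G) = \sum_{u\in V(G)} f(d_u)$. For $n\ge 4$ and $3\le \Delta\le n-1$, $\mathcal{H}_n^\Delta$ is the set of graphs (up to isomorphism) obtained from a cycle $C_k$, with $3\le k\le n-\Delta+2$, by attaching to one and the same vertex of the cycle $\Delta-2$ paths of lengths $m_1,\dots,m_{\Delta-2}\ge 1$ (each path having that cycle vertex as an end-vertex, and the paths being otherwise disjoint from each other and from the cycle), where $k+m_1+\dots+m_{\Delta-2}=n$. Equivalently, $\mathcal{H}_n^\Delta$ is the set of unicyclic graphs with $n$ vertices whose degree sequence is $(\Delta,2,\dots,2,1,\dots,1)$ with $n-\Delta+1$ entries equal to $2$ and $\Delta-2$ entries equal to $1$.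
   Formalization: The ''only if'' part (equality implies G in H_n^Δ) is proved only for strictly concave f, since it fails for affine f (e.g. f(x)=x, triangle with pendants at two distinct vertices); the inequality and the ''if'' part hold for every concave f. *)

(* Defs.v *)
From HB Require Import structures.
From mathcomp Require Import all_boot all_order all_algebra.
From mathcomp Require Import interval_inference.
From mathcomp Require Import classical_sets set_interval reals convex.

Set Implicit Arguments.
Unset Strict Implicit.
Unset Printing Implicit Defensive.

Import Order.TTheory GRing.Theory Num.Theory.

Local Open Scope ring_scope.

Record sgraph := SGraph {
  vertex :> finType;
  adj : rel vertex;
  adj_sym : symmetric adj;
  adj_irr : irreflexive adj }.

Definition isomorphic (G H : sgraph) : Prop :=
  exists2 g : G -> H, bijective g & forall x y, adj (g x) (g y) = adj x y.

Definition connected (G : sgraph) : Prop :=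
  forall x y : G, connect (@adj G) x y.

Definition degree (G : sgraph) (x : G) : nat := #|[set y | adj x y]|.

Definition max_degree (G : sgraph) : nat := (\max_(x : G) degree x)%N.

Definition is_cycle (G : sgraph) (c : seq G) : bool :=
  (2 < size c)%N && ucycleb (@adj G) c.

(* A cycle of [G], as a subgraph, is determined by its set of edges; the
   sequences [c] visiting it are determined only up to rotation and reversal. *)
Definition cycle_edges (G : sgraph) (c : seq G) : {set {set G}} :=
  [set [set x; next c x] | x in c].

Definition unicyclic (G : sgraph) : Prop :=
  exists2 c : seq G, is_cycle c &
    forall c' : seq G, is_cycle c' -> cycle_edges c' = cycle_edges c.

(* The vertices are those of the cycle C_k together with, for each i, the m i
   vertices of the i-th attached path other than its end-vertex on the cycle,
   numbered from the cycle outwards. All paths are attached at vertex 0 of the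
   cycle. *)
Section CycleWithPaths.
Variables (k p : nat) (m : 'I_p -> nat).

Definition cwp_vertex : finType := ('I_k + {i : 'I_p & 'I_(m i)})%type.

Definition cwp_arc (u v : cwp_vertex) : bool :=
  match u, v with
  | inl i, inl j => (j : nat) == (i.+1 %% k)%N
  | inl i, inr b => ((i : nat) == 0%N) && ((tagged b : nat) == 0%N)
  | inr a, inr b => (tag a == tag b) && ((tagged b : nat) == (tagged a).+1)
  | inr _, inl _ => false
  end.

Definition cwp_adj : rel cwp_vertex :=
  fun u v => (u != v) && (cwp_arc u v || cwp_arc v u).

Lemma cwp_adj_sym : symmetric cwp_adj.
Proof. by move=> u v; rewrite /cwp_adj eq_sym orbC. Qed.

Lemma cwp_adj_irr : irreflexive cwp_adj.
Proof. by move=> u; rewrite /cwp_adj eqxx. Qed.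

Definition cycle_with_paths : sgraph := SGraph cwp_adj_sym cwp_adj_irr.
End CycleWithPaths.

Definition in_H (n Delta : nat) (G : sgraph) : Prop :=
  exists (k : nat) (m : 'I_(Delta - 2) -> nat),
    [/\ (3 <= k <= n - Delta + 2)%N,
        (forall i, 1 <= m i)%N,
        (k + \sum_i m i)%N = n
      & isomorphic G (cycle_with_paths k m)].

Definition f_index (R : realType) (f : R -> R) (G : sgraph) : R :=
  \sum_(u : G) f (degree u)%:R.

(* A function on [1, +oo) is a total function of which only the values on that
   interval are constrained. *)
Definition concave_on (R : realType) (D : set R) (f : R -> R) : Prop :=
  convex_function (D : set (convex_lmodType R^o)) (fun x => - f x : R^o).

Definition strictly_concave_on (R : realType) (D : set R) (f : R -> R) : Prop :=
  forall x y t : R, D x -> D y -> x != y -> 0 < t -> t < 1 ->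
    t * f x + (1 - t) * f y < f (t * x + (1 - t) * y).

(* Main.v *)
(* Sending each vertex of the cycle to its successor and every other vertex to a
   neighbour closer to the cycle gives a map p such that {x, p x} runs once over
   the edges: a further edge would create a second cycle. Hence the degree of x
   is one more than the number of its p-preimages, and the degrees sum to 2n.
   A concave f lies below the line through (1, f 1) and (2, f 2) at the integers
   d >= 1, with equality for d <= 2, and strict concavity makes it strict for
   d > 2. Summing over all vertices but one, v, of degree Delta gives the bound;
   in the strict case, equality forces all vertices other than v to have degree
   at most 2. Then p is injective away from the preimages of v, so v lies on the
   cycle, and a vertex off the cycle is determined by the branch at v containing
   it and its distance to v, which identifies G with a cycle with paths. *)

Require Import Defs.
From HB Require Import structures.
From mathcomp Require Import all_boot all_order all_algebra.
From mathcomp Require Import zify ring lra.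
From mathcomp Require Import interval_inference.
From mathcomp Require Import classical_sets set_interval reals convex.

Import Order.TTheory GRing.Theory Num.Theory.

(** * Simple cycles and the parent map of a unicyclic graph *)

Lemma next_next_neq {T : eqType} (c : seq T) (x : T) :
  uniq c -> 2 < size c -> x \in c -> next c (next c x) != x.
Proof.
move=> uc sc xc; case: (rot_to xc) => i s Es.
rewrite -!(next_rot i uc) Es.
have : uniq (x :: s) by rewrite -Es rot_uniq.
have : 2 < size (x :: s) by rewrite -Es size_rot.
case: s {Es} => [|y [|z s]] //= _; rewrite !inE eqxx !negb_or.
by case/andP=> /and3P[xy xz _] _; rewrite (eq_sym y) (negPf xy) eqxx eq_sym.
Qed.

Section Unicyclic.
Variables (G : sgraph) (c : seq G).
Hypotheses (G_connected : connected G) (c_cycle : is_cycle c).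
Hypothesis c_unique :
  forall c' : seq G, is_cycle c' -> cycle_edges c' = cycle_edges c.

Let c_uniq : uniq c.
Proof. by case/and3P: c_cycle. Qed.

(** A walk from [x] to [y] along [e] shortens to a simple path, which the edge from [y] back to [x]
    closes. *)
Lemma cycle_through_edge {e : rel G} {x y : G} :
  subrel e (@adj G) -> connect e x y -> adj x y -> ~~ e x y ->
  exists2 c' : seq G, is_cycle c' & [set x; y] \in cycle_edges c'.
Proof.
move=> sub_e /connectP[s es ->{y}].
case/shortenP: es => s' es' us' _ {s} xy nexy.
exists (x :: s'); last first.
  apply/imsetP; exists (last x s'); first exact: mem_last.
  have -> : last x s' = prev (x :: s') x.
    case: s' us' {es' xy nexy} => [|a s'] /=; first by rewrite eqxx.
    rewrite inE negb_or => /andP[/andP[/negPf-> +] _].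
    elim: s' a => [|b s' IH] a /=; first by rewrite eqxx.
    by rewrite inE negb_or => /andP[/negPf-> xs]; exact: IH.
  by rewrite next_prev // finset.setUC.
rewrite /is_cycle /ucycleb us' andbT /cycle rcons_path (sub_path sub_e) //.
rewrite [adj (last x s') x]adj_sym xy.
(* The path has an inner vertex: its ends differ since [adj] is irreflexive, and a single step would
   be the excluded [e x y]. *)
case: s' es' {us'} xy nexy => [|y [|z s']] //=; first by rewrite adj_irr.
by rewrite andbT => ->.
Qed.

(* An edge missing from [e] would close a cycle through it, which is not [c]. *)
Lemma unicyclic_sub_adj {e : rel G} :
  symmetric e -> subrel e (@adj G) -> (forall x y, connect e x y) ->
  {in c, forall x, e x (next c x)} -> @adj G =2 e.
Proof.
move=> sym_e sub_e con_e ce x y; apply/idP/idP => [xy|/sub_e //].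
apply/negPn/negP => nexy.
have [c' /c_unique ->] := cycle_through_edge sub_e (con_e x y) xy nexy.
case/imsetP=> z zc Exy; have ez := ce z zc.
have xNy : x != y by apply: contraTneq xy => ->; rewrite adj_irr.
have [] : x \in [set z; next c z] /\ y \in [set z; next c z].
  by rewrite -Exy !inE !eqxx orbT.
rewrite !inE => /orP[]/eqP xE /orP[]/eqP yE; move: nexy xNy;
  by rewrite xE yE ?eqxx ?ez // sym_e ez.
Qed.

Let reach (x : G) (n : nat) : bool :=
  [exists s : n.-tuple G, path (@adj G) x s && (last x s \in c)].

Lemma reach_ex x : exists n, reach x n.
Proof.
have [y yc] : exists y, y \in c.
  by case: (c) c_cycle => // y s _; exists y; rewrite inE eqxx.
have /connectP[s xs Ey] := G_connected x y.
by exists (size s); apply/existsP; exists (in_tuple s); rewrite xs -Ey.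
Qed.

(* [r] is the distance to the cycle. *)
Lemma unicyclic_parent :
  exists (p : G -> G) (r : G -> nat),
    [/\ {in c, p =1 next c},
        forall x, (r x == 0) = (x \in c),
        forall x, x \notin c -> r x = (r (p x)).+1
      & forall x y, adj x y = (y == p x) || (x == p y)].
Proof.
pose r x := ex_minn (reach_ex x).
have r0 x : (r x == 0) = (x \in c).
  rewrite /r; case: ex_minnP => n nr nmin; apply/eqP/idP => [n0|xc].
    by move: nr; rewrite n0 => /existsP[s]; rewrite tuple0 /=.
  by apply/eqP; rewrite -leqn0 nmin //; apply/existsP; exists [tuple].
have r_adj x y : adj x y -> r x <= (r y).+1.
  rewrite /r; case: ex_minnP => n _ nmin; case: ex_minnP => m /existsP[s].
  move=> /andP[ys sc] _ xy; apply: nmin; apply/existsP.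
  by exists [tuple of y :: s]; rewrite /= xy ys.
have r_par x : x \notin c -> {y | adj x y && (r x == (r y).+1)}.
  move=> xc; apply: sigW; have : r x != 0 by rewrite r0.
  rewrite {1 2}/r; case: ex_minnP => -[//|n] /existsP[] /tupleP[y s] /=.
  move=> /andP[/andP[xy ys] sc] nmin _; exists y; rewrite xy /=.
  have rxn : n < r x by rewrite /r; case: ex_minnP => m /nmin.
  have : r y <= n.
    rewrite /r; case: ex_minnP => m _; apply; apply/existsP; exists s.
    by rewrite ys.
  by have := r_adj x y xy; lia.
(* The default [x] of [odflt] is never taken: [r_par] provides a neighbour closer to the cycle. *)
pose p x := if x \in c then next c x
            else odflt x [pick y | adj x y && (r x == (r y).+1)].
have pc : {in c, p =1 next c} by move=> x xc; rewrite /p xc.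
have pNc x : x \notin c -> adj x (p x) /\ r x = (r (p x)).+1.
  move=> xc; rewrite /p (negPf xc); case: pickP => [y /andP[? /eqP]|] //=.
  by case: (r_par x xc) => y Hy /(_ y); rewrite Hy.
have adj_p x : adj x (p x).
  have [xc|/pNc[]//] := boolP (x \in c).
  by rewrite pc //; case/and3P: c_cycle => _ /next_cycle + _; apply.
exists p, r; split => // [x /pNc[]//|].
(* The edges {x, p x} contain the cycle and connect the graph: iterating [p] leads every vertex to
   [c], which is itself an orbit of [p]. *)
apply: unicyclic_sub_adj => [x y|x y|x y|x xc].
- by rewrite orbC.
- by case/orP=> /eqP ->; rewrite // adj_sym.
- pose e x y := (y == p x) || (x == p y).
  have sym_e : symmetric e by move=> u v; rewrite /e orbC.
  have e_p u : connect e u (p u) by rewrite connect1 // /e eqxx.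
  have to_c u : exists2 w, w \in c & connect e u w.
    elim: {u}(r u) {-2}u (erefl (r u)) => [|n IH] u Hu.
      by exists u => //; rewrite -r0 Hu.
    have /pNc[_] : u \notin c by rewrite -r0 Hu.
    rewrite Hu => -[/esym/IH[w wc uw]]; exists w => //.
    exact: connect_trans uw.
  have [u uc xu] := to_c x; have [w wc yw] := to_c y.
  apply: connect_trans xu _; rewrite (sym_connect_sym sym_e) in yw.
  apply: connect_trans yw.
  have c_p : fcycle p c.
    by apply: cycle_from_next => // z zc; rewrite /= pc.
  have: fconnect p u w by rewrite (fconnect_cycle c_p uc).
  by apply: connect_sub => a b /= /eqP <-; exact: e_p.
- by rewrite pc ?eqxx.
Qed.
End Unicyclic.

(** * Degrees in terms of the parent map *)

Section ParentStructure.
Variables (G : sgraph) (c : seq G) (p : G -> G) (r : G -> nat).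
Hypotheses (c_uniq : uniq c) (c_size : 2 < size c).
Hypothesis p_next : {in c, p =1 next c}.
Hypothesis r_eq0 : forall x, (r x == 0) = (x \in c).
Hypothesis r_p : forall x, x \notin c -> r x = (r (p x)).+1.
Hypothesis adjE : forall x y : G, adj x y = (y == p x) || (x == p y).

(** On the cycle this is where length at least 3 matters; off it, either [p x] is on the cycle,
    which [p] never leaves, or [r] drops twice. Hence the parent of [x] is not also one of its
    children. *)
Lemma pp_neq x : p (p x) != x.
Proof.
have [xc|xc] := boolP (x \in c).
  have pxc : next c x \in c by rewrite mem_next.
  by rewrite !p_next ?p_next //; exact: next_next_neq.
have [pxc|pxc] := boolP (p x \in c).
  by apply: contraNneq xc => <-; rewrite p_next // mem_next.
by apply/eqP => pp; have := r_p x xc; have := r_p _ pxc; rewrite pp; lia.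
Qed.

Lemma degree_children x : degree x = #|[set y | p y == x]|.+1.
Proof.
have -> : degree x = #|p x |: [set y | p y == x]|.
  by apply: eq_card => y; rewrite !inE adjE (eq_sym x).
by rewrite cardsU1 inE pp_neq.
Qed.

(** Every vertex is the child of exactly one vertex, so the numbers of children add up to [#|G|]. *)
Lemma sum_degree : \sum_(x : G) degree x = 2 * #|G|.
Proof.
under eq_bigr => x _ do rewrite degree_children -add1n.
rewrite big_split /= sum1_card mul2n -addnn; congr (_ + _).
under eq_bigr => x _ do rewrite cardsE -sum1_card.
by rewrite -sum1_card [RHS](partition_big p predT).
Qed.

(** If [v] were off the cycle, induction on [r] would put every vertex on it: a cycle vertex has its
    predecessor as a child, and a child off the cycle would give it degree 3. *)
Lemma branching_on_cycle v :
  (forall x, x != v -> degree x <= 2) -> v \in c.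
Proof.
move=> degree_le2; apply/negPn/negP => vc.
suff /(_ v) : forall x, x \in c by rewrite (negPf vc).
move=> x; elim: {x}(r x) {-2}x (erefl (r x)) => [|n IH] x Hx.
  by rewrite -r_eq0 Hx.
have [//|xc] := boolP (x \in c).
have pxc : p x \in c by apply: IH; move: Hx; rewrite r_p // => -[].
have pxv : p x != v by apply: contraNneq vc => <-.
have := degree_le2 _ pxv; rewrite degree_children ltnS => /card_le1_eqP E.
suff px : prev c (p x) = x by rewrite -px mem_prev pxc in xc.
by apply: E; rewrite inE // p_next ?mem_prev // next_prev.
Qed.

(** * Identification of the branches at [v] with attached paths *)

Section Branches.
Variables (v : G) (q : seq G).
Hypothesis c_def : c = v :: q.
Hypothesis degree_le2 : forall x, x != v -> degree x <= 2.

Let vc : v \in c.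
Proof. by rewrite c_def mem_head. Qed.

Let p_inj x y : p x = p y -> p x != v -> x = y.
Proof.
move=> pxy pxv; have := degree_le2 _ pxv.
by rewrite degree_children ltnS => /card_le1_eqP; apply; rewrite inE ?pxy.
Qed.

Let p_c x : x \in c -> p x \in c.
Proof. by move=> xc; rewrite p_next // mem_next. Qed.

Let p_prev x : x \in c -> p (prev c x) = x.
Proof. by move=> xc; rewrite p_next ?mem_prev // next_prev. Qed.

(** A cycle vertex other than [v] has room for one child only, its predecessor on the cycle. *)
Let p_off x : x \notin c -> p x \in c -> p x = v.
Proof.
move=> xc pxc; apply/eqP/negPn/negP => pxv.
have := p_inj (prev c (p x)) x; rewrite p_prev // => /(_ erefl pxv) E.
by rewrite -E mem_prev pxc in xc.
Qed.

(* The vertex through which the branch of [x] is attached to the cycle. *)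
Let root x := iter (r x).-1 p x.

Let root_p x : x \notin c -> p x \notin c -> root (p x) = root x.
Proof.
move=> xc pxc; rewrite /root (r_p x xc) /=.
have := r_p _ pxc; case: (r (p x)) => // n _ /=.
by rewrite -iterS iterSr.
Qed.

(** The first vertices of the branches at [v]; they index the attached paths. *)
Let W := [set x | (x \notin c) && (p x == v)].

Let root_W x : x \notin c -> root x \in W.
Proof.
elim: {x}(r x) {-2}x (erefl (r x)) => [|n IH] x Hx xc.
  by rewrite -r_eq0 Hx in xc.
have [pxc|pxc] := boolP (p x \in c).
  have r1 : r x = 1 by rewrite r_p //; move: pxc; rewrite -r_eq0 => /eqP ->.
  by rewrite /root r1 /= inE xc p_off ?eqxx.
by rewrite -root_p //; apply: IH => //; move: Hx; rewrite r_p // => -[].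
Qed.

Let root_id x : x \in W -> root x = x /\ r x = 1.
Proof.
rewrite inE => /andP[xc /eqP px]; suff r1 : r x = 1 by rewrite /root r1.
by rewrite r_p // px; move: vc; rewrite -r_eq0 => /eqP ->.
Qed.

(** Induction on the distance to the cycle: the parents share root and depth, hence coincide, and
    [p] is injective where its value is not [v]. *)
Let root_inj x y : x \notin c -> y \notin c ->
  root x = root y -> r x = r y -> x = y.
Proof.
elim: {x}(r x) {-2}x y (erefl (r x)) => [|n IH] x y Hx xc yc.
  by rewrite -r_eq0 Hx in xc.
have [pxc|pxc] := boolP (p x \in c).
  have r1 : r x = 1 by rewrite r_p //; move: pxc; rewrite -r_eq0 => /eqP ->.
  by rewrite /root => + rxy; rewrite -rxy r1.
have rpx : r (p x) = n by move: Hx; rewrite r_p // => -[].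
move=> Exy rxy; have rpy : r (p y) = n.
  by move: rxy; rewrite Hx (r_p y) // => -[].
have pyc : p y \notin c by rewrite -r_eq0 rpy -rpx r_eq0.
apply: p_inj; last by apply: contraNneq pxc => ->.
by apply: IH => //; rewrite ?root_p // rpx rpy.
Qed.

(** The children of [v] are [W] and its predecessor on the cycle; its parent accounts for the other
    unit. *)
Let card_W : #|W| = degree v - 2.
Proof.
rewrite degree_children.
have -> : [set y | p y == v] = prev c v |: W.
  apply/setP => y; rewrite !inE; have [yc|yc] /= := boolP (y \in c).
    rewrite orbF; apply/eqP/eqP => [<-|->]; last exact: p_prev.
    by rewrite p_next // prev_next.
  by case: (eqVneq y) yc => // ->; rewrite mem_prev vc.
by rewrite cardsU1 inE mem_prev vc /= add1n subn2.
Qed.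

(** The length of the path starting at the [i]-th element of [W], counted as the vertices of that
    branch. *)
Let m (i : 'I_#|W|) := #|[set x | (x \notin c) && (root x == enum_val i)]|.

Let m_gt0 i : 0 < m i.
Proof.
apply/card_gt0P; exists (enum_val i); have Wi := enum_valP i.
by rewrite inE (root_id _ Wi).1 eqxx andbT; move: Wi; rewrite inE => /andP[].
Qed.

(** The iterates [iter j p x] for [j < r x] are distinct vertices of the branch of [x]. *)
Let depth_lt x i : x \notin c -> root x = enum_val i -> r x <= m i.
Proof.
move=> xc xi.
have iterP j : j < r x ->
    [/\ iter j p x \notin c, root (iter j p x) = root x
       & r (iter j p x) = r x - j].
  elim: j => [|j IH] jr; first by rewrite subn0.
  have [jc Ej Rj] := IH (ltnW jr).
  have Rj1 : r (iter j.+1 p x) = r x - j.+1.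
    by have := r_p _ jc; rewrite /= Rj; lia.
  have jc1 : iter j.+1 p x \notin c by rewrite -r_eq0 Rj1; lia.
  by split => //; rewrite -Ej; exact: root_p.
have inj : injective (fun j : 'I_(r x) => iter j p x).
  move=> j k /(congr1 r).
  have [_ _ ->] := iterP j (ltn_ord j); have [_ _ ->] := iterP k (ltn_ord k).
  by move=> E; apply: val_inj => /=; have := ltn_ord j; have := ltn_ord k; lia.
rewrite -[X in X <= _]card_ord -(card_imset _ inj); apply: subset_leq_card.
apply/fintype.subsetP => _ /imsetP[j _ ->].
have [jc Ej _] := iterP j (ltn_ord j).
by rewrite inE jc Ej xi eqxx.
Qed.

Let sum_m : size c + \sum_i m i = #|G|.
Proof.
rewrite -(card_uniqP c_uniq) -(cardC [in c]); congr (_ + _).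
(* The vertices off the cycle are partitioned by [root]. [enum_rank_in] requires an element of [W],
   so the case of no branch is separate. *)
have [W0|[w0 W0]] := set_0Vmem W.
  have -> : \sum_i m i = 0.
    apply: big1 => i _; have : enum_val i \in W := enum_valP i.
    by move: (enum_val i) => x; rewrite W0 inE.
  apply/esym/eq_card0 => x; apply/negbTE/negP; rewrite !inE => xc.
  by have := root_W x xc; rewrite W0 inE.
rewrite -[RHS]sum1_card.
rewrite (partition_big (fun x => enum_rank_in W0 (root x)) predT) //.
apply: eq_bigr => i _; rewrite /m -sum1dep_card; apply: eq_bigl => x.
rewrite !inE; have [//|xc] /= := boolP (x \in c).
apply/eqP/eqP => [->|<-]; first by rewrite enum_valK_in.
by rewrite enum_rankK_in // root_W.
Qed.

Let index_p x : x \in c -> index (p x) c = (index x c).+1 %% size c.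
Proof.
move=> xc; rewrite p_next // next_nth xc; move: xc c_uniq.
rewrite c_def => + uc; rewrite -index_mem.
move: (index x (v :: q)) => j; rewrite [size _]/= ltnS leq_eqVlt.
(* At the last vertex of [c], [nth] returns its default [v], which is the successor around the
   cycle. *)
case/predU1P=> [->|jq]; first by rewrite nth_default //= eqxx modnn.
by rewrite modn_small // -[nth v q j]/(nth v (v :: q) j.+1) index_uniq.
Qed.

(** Coordinates of [x] in the model. Depth off the cycle starts at 1 but positions on a path start
    at 0, whence the successor. *)
Let pos (x : G) (u : cwp_vertex (size c) m) : Prop :=
  match u with
  | inl i => x \in c /\ index x c = i
  | inr b => [/\ x \notin c, root x = enum_val (tag b) & r x = (tagged b).+1]
  end.

Let pos_ex x : exists u, pos x u.
Proof.
have [xc|xc] := boolP (x \in c).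
  by have ic := xc; rewrite -index_mem in ic; exists (inl (Ordinal ic)).
have Wx := root_W x xc; pose i := enum_rank_in Wx (root x).
have xi : root x = enum_val i by rewrite enum_rankK_in.
have lt_m : (r x).-1 < m i.
  by rewrite prednK ?depth_lt // lt0n r_eq0.
exists (inr (Tagged (fun i => 'I_(m i)) (Ordinal lt_m))); split => //=.
by rewrite prednK // lt0n r_eq0.
Qed.

Let pos_inj x y u : pos x u -> pos y u -> x = y.
Proof.
case: u => [i|b] /= => [[xc xi] [yc yi]|[xc xb rx] [yc yb ry]].
  by rewrite -(nth_index v xc) xi -yi nth_index.
by apply: root_inj; rewrite ?xb ?rx.
Qed.

(** Arcs of the model follow [p] on the cycle but run against it on the paths, which point
    outwards. *)
Let pos_arc x y a b : pos x a -> pos y b ->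
  cwp_arc a b = if y \in c then (x \in c) && (y == p x) else x == p y.
Proof.
case: a => [i|a]; case: b => [j|b] /=.
- move=> [xc xi] [yc yj]; rewrite yc xc /= -yj -xi -index_p //.
  apply/eqP/eqP => [E|-> //].
  by rewrite -(nth_index v yc) E nth_index // p_c.
- move=> [xc xi] [yc yb ry]; rewrite (negPf yc) -xi.
  have -> : ((tagged b : nat) == 0) = (p y \in c).
    by rewrite -r_eq0 -[RHS]eqSS -r_p // ry eqSS.
  apply/andP/eqP => [[x0 pyc]|xE].
    by rewrite p_off // -(nth_index v xc) (eqP x0) c_def.
  by rewrite -xE; split=> //; rewrite xE p_off -?xE // c_def /= eqxx.
- by move=> [xc _ _] [yc _]; rewrite yc (negPf xc).
- move=> [xc xa rx] [yc yb ry]; rewrite (negPf yc).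
  have -> : ((tagged b : nat) == (tagged a).+1) = (r (p y) == r x).
    by rewrite -[RHS]eqSS -r_p // rx ry eqSS.
  have tagE : (tag a == tag b) = (root x == root y).
    by rewrite xa yb (inj_eq enum_val_inj).
  rewrite tagE; apply/andP/eqP => [[/eqP xy /eqP rxy]|xy].
    have pyc : p y \notin c by rewrite -r_eq0 rxy r_eq0.
    by apply: root_inj; rewrite ?root_p.
  by rewrite -(root_p y) -?xy ?eqxx.
Qed.

Lemma parent_in_H : 2 < degree v -> in_H #|G| (degree v) G.
Proof.
move=> dv; rewrite /in_H -card_W.
have [g gP] := fin_all_exists pos_ex.
exists (size c), m; split=> //.
(* Each of the [degree v - 2] paths has a vertex, which bounds the cycle length from above. *)
- have : \sum_(i < #|W|) 1 <= \sum_i m i by apply: leq_sum.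
  have := sum_m; move: (\sum_i m i) => s.
  by rewrite sum1_card card_ord card_W; lia.
- have g_inj : injective g.
    by move=> x y gxy; apply: (pos_inj _ _ (g y)) => //; rewrite -gxy.
  exists g.
    apply: inj_card_bij => //; rewrite -sum_m card_sum card_ord card_tagged.
    rewrite sumnE big_map big_enum /=.
    by under eq_bigr => i _ do rewrite card_ord.
  move=> x y; rewrite /= /cwp_adj (inj_eq g_inj).
  rewrite (pos_arc _ _ _ _ (gP x) (gP y)) (pos_arc _ _ _ _ (gP y) (gP x)).
  case: eqVneq => [<-|xy] /=; first by rewrite adj_irr.
  have pNeq u w : u \in c -> w \notin c -> (w == p u) = false.
    by move=> uc wc; apply: contraNF wc => /eqP ->; exact: p_c.
  rewrite adjE.
  have [xc|xc] := boolP (x \in c); have [yc|yc] := boolP (y \in c).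
  - by [].
  - by rewrite (pNeq x y) // orbF.
  - by rewrite (pNeq y x) // orbF.
  - by rewrite orbC.
Qed.
End Branches.
End ParentStructure.

(** * Consequences for unicyclic graphs *)

Lemma unicyclic_degree (G : sgraph) : connected G -> unicyclic G ->
  \sum_(x : G) degree x = 2 * #|G| /\ forall x : G, 0 < degree x.
Proof.
move=> conG [c c_cycle c_unique].
have [p [r [p_next r0 rp adjE]]] := unicyclic_parent _ _ conG c_cycle c_unique.
have /and3P[c_size _ c_uniq] := c_cycle.
split=> [|x]; first exact: (sum_degree G c p r).
by rewrite (degree_children G c p r).
Qed.

Lemma unicyclic_in_H (G : sgraph) (v : G) :
  connected G -> unicyclic G -> 2 < degree v ->
  (forall x, x != v -> degree x <= 2) -> in_H #|G| (degree v) G.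
Proof.
move=> conG [c c_cycle c_unique] dv dle2.
have [p [r [p_next r0 rp adjE]]] := unicyclic_parent _ _ conG c_cycle c_unique.
have /and3P[c_size _ c_uniq] := c_cycle.
have vc : v \in c by exact: (branching_on_cycle G c p r).
(* The paths of the model are attached at vertex 0, so the cycle is rotated to begin with [v]. *)
have [i q rot_c] := rot_to vc.
apply: (parent_in_H G (rot i c) p r) rot_c _ dv => //.
- by rewrite rot_uniq.
- by rewrite size_rot.
- by move=> x; rewrite mem_rot next_rot // => /p_next.
- by move=> x; rewrite mem_rot.
- by move=> x; rewrite mem_rot => /rp.
Qed.

(** * Degrees in a cycle with paths *)

Lemma cwp_arc_out_le1 (k p : nat) (m : 'I_p -> nat) (x : cwp_vertex k m) :
  (if x is inl i then i != 0 :> nat else true) ->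
  #|[set y | cwp_arc x y]| <= 1.
Proof.
move=> xP; apply/card_le1_eqP => y z; rewrite !inE.
case: x xP => [i|[i a]]; case: y => [j|[j b]]; case: z => [l|[l d]] //=;
  try by move=> /negPf ->.
- by move=> _ /eqP ji /eqP li; congr inl; apply: val_inj; rewrite /= ji li.
- move=> _ /andP[/eqP ij /eqP bE] /andP[/eqP il /eqP dE].
  rewrite /= in ij il; subst j l; congr (inr (existT _ _ _)).
  by apply: val_inj; rewrite /= in bE dE *; rewrite bE dE.
Qed.

Lemma cwp_arc_in_le1 (k p : nat) (m : 'I_p -> nat) (x : cwp_vertex k m) :
  #|[set y | cwp_arc y x]| <= 1.
Proof.
apply/card_le1_eqP => y z; rewrite !inE.
case: x => [i|[i a]]; case: y => [j|[j b]]; case: z => [l|[l d]] //=.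
- move=> /eqP -> /eqP; rewrite -[_.+1]addn1 -[l.+1]addn1 => /eqP.
  rewrite eqn_modDr !modn_small // => /eqP jl.
  by congr inl; apply: val_inj.
- move=> /andP[/eqP j0 _] /andP[/eqP l0 _].
  by congr inl; apply: val_inj; rewrite /= j0 l0.
- by rewrite /= => /andP[_ /eqP ->] /andP[_].
- by rewrite /= => /andP[_ /eqP ->] /andP[_].
- move=> /andP[/eqP ij /eqP bE] /andP[/eqP il /eqP dE].
  rewrite /= in ij il; subst j l; congr (inr (existT _ _ _)).
  by apply: val_inj; move: dE; rewrite /= in bE *; rewrite bE => -[].
Qed.

(** Only the attachment vertex can have more than one outgoing arc, and no vertex has more than one
    incoming arc. *)
Lemma cwp_degree_gt2 (k p : nat) (m : 'I_p -> nat)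
    (x : cycle_with_paths k m) :
  2 < degree x -> if x is inl i then i == 0 :> nat else false.
Proof.
apply: contraTT => xP; rewrite -leqNgt.
apply: (@leq_trans (#|[set y | cwp_arc x y]| + #|[set y | cwp_arc y x]|)).
  apply: leq_trans (leq_card_setU _ _); apply: subset_leq_card.
  by apply/fintype.subsetP => y; rewrite !inE => /andP[].
apply: (leq_add (_ : _ <= 1) (_ : _ <= 1)); last exact: cwp_arc_in_le1.
by apply: cwp_arc_out_le1; case: x xP.
Qed.

Lemma isomorphic_degree (G H : sgraph) (g : G -> H) :
  bijective g -> (forall x y, adj (g x) (g y) = adj x y) ->
  forall x, degree (g x) = degree x.
Proof.
move=> g_bij gE x; rewrite /degree -(card_imset _ (bij_inj g_bij)).
apply: eq_card => y; have [h gh hg] := g_bij; rewrite -(hg y).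
by rewrite (mem_imset _ _ (bij_inj g_bij)) !inE gE.
Qed.

(** An isomorphism sends every vertex of degree above 2 to vertex 0 of the cycle, so there is at
    most one. *)
Lemma in_H_degree_le2 (n Delta : nat) (G : sgraph) (v : G) :
  in_H n Delta G -> 2 < degree v -> forall x, x != v -> degree x <= 2.
Proof.
move=> [k [m [_ _ _ [g g_bij gE]]]] dv x; apply: contraR; rewrite -ltnNge => dx.
have dg := isomorphic_degree _ _ _ g_bij gE.
rewrite -dg in dv; rewrite -dg in dx.
have := cwp_degree_gt2 _ _ _ _ dv; have := cwp_degree_gt2 _ _ _ _ dx.
case gx: (g x) => [i|//] /eqP i0; case gv: (g v) => [j|//] /eqP j0.
apply/eqP/(bij_inj g_bij); rewrite gx gv; congr inl.
by apply: val_inj; rewrite /= i0 j0.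
Qed.

(** * Concave functions and the chord through 1 and 2 *)

Local Open Scope ring_scope.

(** The line through [(1, f 1)] and [(2, f 2)], evaluated at [d]. *)
Definition chord (R : realType) (f : R -> R) (d : nat) : R :=
  f 2 + (d%:R - 2) * (f 2 - f 1).

Section Concave.
Variables (R : realType) (f : R -> R).
Local Notation chord := (chord R f).

Lemma chord_small d : (0 < d <= 2)%N -> f d%:R = chord d.
Proof. by case: d => [|[|[|d]]] // _; rewrite /chord; ring. Qed.

Section Weight.
Variable d : nat.
Hypothesis d_gt2 : (2 < d)%N.

(** The weight that makes 2 a convex combination of 1 and [d]. *)
Let w : R := (d%:R - 2) / (d%:R - 1).

Let dR : 3 <= d%:R :> R.
Proof. by rewrite ler_nat. Qed.

Let w_gt0 : 0 < w.
Proof. by rewrite divr_gt0 //; have := dR; lra. Qed.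

Let w_lt1 : w < 1.
Proof. by rewrite ltr_pdivrMr; have := dR; lra. Qed.

Let w_comb : w * 1 + (1 - w) * d%:R = 2.
Proof. by rewrite /w; field; have := dR; lra. Qed.

(** The factor [d - 1] is the inverse of [1 - w], so the sign of the gap is that of the concavity
    defect at 2. *)
Let chord_gap :
  chord d - f d%:R = (d%:R - 1) * (f 2 - (w * f 1 + (1 - w) * f d%:R)).
Proof. by rewrite /chord /w; field; have := dR; lra. Qed.

Lemma concave_le_chord_gt2 :
  concave_on `[1, +oo[%classic f -> f d%:R <= chord d.
Proof.
move=> f_conc.
have in1 x : 1 <= x -> x \in (`[1, +oo[%classic : set R).
  by move=> x1; rewrite inE /= in_itv /= x1.
have d1 : 1 <= d%:R :> R by have := dR; lra.
have : - f (w * 1 + (1 - w) * d%:R) <= w * - f 1 + (1 - w) * - f d%:R :=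
  f_conc (Itv01 (ltW w_gt0) (ltW w_lt1)) _ _ (in1 _ (lexx 1)) (in1 _ d1).
rewrite w_comb => ineq; rewrite -subr_ge0 chord_gap mulr_ge0 //; lra.
Qed.

Lemma strictly_concave_lt_chord :
  strictly_concave_on `[1, +oo[%classic f -> f d%:R < chord d.
Proof.
move=> f_conc; have d3 := dR.
have := f_conc 1 d%:R w _ _ _ w_gt0 w_lt1.
rewrite w_comb /= !in_itv /= !andbT lexx => /(_ isT) ineq.
rewrite -subr_gt0 chord_gap mulr_gt0 //; first by lra.
rewrite subr_gt0 ineq //; first by lra.
by rewrite lt_eqF //; lra.
Qed.
End Weight.

Lemma concave_le_chord d :
  concave_on `[1, +oo[%classic f -> (0 < d)%N -> f d%:R <= chord d.
Proof.
move=> f_conc d0; have [d2|d2] := leqP d 2; last exact: concave_le_chord_gt2.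
by rewrite chord_small ?d0.
Qed.

(** [chord] is affine in the degree, so its sum depends only on the number of vertices and the sum
    of the degrees. *)
Lemma sum_chord (G : sgraph) (v : G) :
  (\sum_(x : G) degree x = 2 * #|G|)%N ->
  f (degree v)%:R + \sum_(x : G | x != v) chord (degree x) =
  f (degree v)%:R + (#|G|%:R - (degree v)%:R + 1) * f 2
    + ((degree v)%:R - 2) * f 1.
Proof.
move=> sumG; rewrite -addrA; congr (_ + _).
have /(congr1 (fun k => k%:R : R)) := sumG.
rewrite (bigD1 v) //= natrD natr_sum natrM => sumR.
have cardG : \sum_(x : G | x != v) 1 = #|G|%:R - 1 :> R.
  rewrite -[#|G|]sum1_card natr_sum [X in _ = X - 1](bigD1 v) //=; ring.
rewrite /chord big_split /= -mulr_suml sumrB.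
rewrite -[f 2 in LHS]mul1r -[2 in X in _ - X]mul1r -!mulr_suml cardG.
have -> : \sum_(x : G | x != v) (degree x)%:R =
    2 * #|G|%:R - (degree v)%:R :> R.
  by rewrite -sumR; ring.
by ring.
Qed.

End Concave.

(** * The bound on [f_index] and its equality case *)

Theorem theorem4p5 (R : realType) (G : sgraph) (n Delta : nat) (f : R -> R)
    (G_connected : connected G) (G_unicyclic : unicyclic G)
    (card_G : #|G| = n) (n_ge4 : (4 <= n)%N)
    (maxdeg_G : max_degree G = Delta) (Delta_ge3 : (3 <= Delta)%N)
    (f_concave : concave_on `[1, +oo[%classic f) :
  let bound := f Delta%:R + (n%:R - Delta%:R + 1) * f 2
               + (Delta%:R - 2) * f 1 in
  [/\ f_index f G <= bound,
      in_H n Delta G -> f_index f G = bound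
    & strictly_concave_on `[1, +oo[%classic f ->
        (f_index f G = bound <-> in_H n Delta G)].
Proof.
have [sumG deg_gt0] := unicyclic_degree G G_connected G_unicyclic.
have G_gt0 : (0 < #|G|)%N by rewrite card_G (leq_trans _ n_ge4).
have [v Ev] := bigop.eq_bigmax (@degree G) G_gt0.
have dv : degree v = Delta by rewrite -maxdeg_G /max_degree Ev.
rewrite /= -card_G -{}dv in Delta_ge3 *; rewrite -sum_chord //.
have index_v :
    f_index f G = f (degree v)%:R + \sum_(x | x != v) f (degree x)%:R.
  by rewrite /f_index (bigD1 v).
have le_chord (x : G) : f (degree x)%:R <= chord R f (degree x).
  exact: concave_le_chord.
have attained : in_H #|G| (degree v) G ->
    f_index f G = f (degree v)%:R + \sum_(x | x != v) chord R f (degree x).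
  move=> /in_H_degree_le2 deg_le2; rewrite index_v; congr (_ + _).
  apply: eq_bigr => x xv; apply: chord_small.
  by rewrite deg_gt0 (deg_le2 v).
split=> // [|f_strict]; first by rewrite index_v lerD2l ler_sum.
split=> //; rewrite index_v => /addrI sum_eq.
apply: unicyclic_in_H => // x xv; rewrite leqNgt; apply/negP => dx.
(* Nonnegative gaps with sum zero all vanish, whereas strict concavity makes the gap at [x]
   positive. *)
have gap0 : \sum_(y : G | y != v)
    (chord R f (degree y) - f (degree y)%:R) = 0.
  by rewrite sumrB sum_eq subrr.
have gap_ge0 (y : G) : y != v ->
    0 <= chord R f (degree y) - f (degree y)%:R.
  by rewrite subr_ge0.
have /eqP := psumr_eq0P gap_ge0 gap0 xv.
by rewrite subr_eq0 gt_eqF // strictly_concave_lt_chord.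
Qed.
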